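(* A finite soluble group $G$ satisfies the strong replacement property if and only if one of the following occurs: (1) $G$ is an elementary abelian $p$-group for some prime $p$. (2) $G\cong V^t\rtimes H$ for some positive integer $t$, where $H$ is a cyclic group of prime order and $V$ is a faithful irreducible $H$-module.
   Context: Let $G$ be a finite group. A generating set (generating sequence) $\Omega=\{g_1,\dots,g_n\}$ of $G$ is called irredundant (or independent) if every proper subset of $\Omega$ generates a proper subgroup of $G$. $G$ satisfies the replacement property for the generating sequence $\{g_1,\dots,g_n\}$ if for every $g\in G$ with $g\neq 1$ there exists $i\in\{1,\dots,n\}$ such that $\{g_1,\dots,g_{i-1},g,g_{i+1},\dots,g_n\}$ generates $G$. $G$ satisfies the strong replacement property if it satisfies the replacement property for all irredundant generating sequences of $G$ (of any length, not only those of maximal length). Conventions: the trivial group counts as an elementary abelian $p$-group (of rank $0$). A faithful irreducible $H$-module $V$ is a finite nontrivial abelian group on which $H$ acts faithfully by automorphisms and which has no $H$-invariant subgroups other than $0$ and $V$ (equivalently, a faithful irreducible finite $\mathbb{F}_pH$-module for some prime $p$). $V^t$ is the direct product of $t$ copies of $V$ with $H$ acting diagonally, and $V^t\rtimes H$ is the corresponding semidirect product. *)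

(* Defs.v *)
From HB Require Import structures.
From mathcomp Require Import all_boot all_fingroup all_solvable.

Set Implicit Arguments.
Unset Strict Implicit.
Unset Printing Implicit Defensive.

Local Open Scope group_scope.

Section Replacement.

Variables (gT : finGroupType) (G : {group gT}).

(* A sequence of length n is a map on 'I_n, possibly with n = 0, and its
   subsets are indexed by subsets of 'I_n, so that an irredundant generating
   sequence has no repeated entry. *)
Definition generating n (g : 'I_n -> gT) : Prop := <<g @: [set: 'I_n]>> = G.

Definition irredundant_generating n (g : 'I_n -> gT) : Prop :=
  generating g /\
  forall J : {set 'I_n}, J \proper [set: 'I_n] -> <<g @: J>> \proper G.

Definition replacement_property n (g : 'I_n -> gT) : Prop :=
  forall x, x \in G -> x != 1 ->
  exists i : 'I_n, generating [eta g with i |-> x].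

Definition strong_replacement_property : Prop :=
  forall n (g : 'I_n -> gT),
  irredundant_generating g -> replacement_property g.

End Replacement.

Section DiagonalAction.

Variables (aT rT : finGroupType) (D : {group aT}) (R : {group rT}).
Variables (to : groupAction D R) (t : nat).

Definition power_group : {group {dffun forall _ : 'I_t, rT}} :=
  [group of setXn (fun _ : 'I_t => R : {set rT})].

(* An action is injective even for a outside D, and a group action is trivial
   outside its range, hence the tests. *)
Definition diagact (x : {dffun forall _ : 'I_t, rT}) (a : aT) :
    {dffun forall _ : 'I_t, rT} :=
  if (a \in D) && (x \in power_group) then [ffun i => to (x i) a] else x.

Lemma diagact_stable x a : (diagact x a \in power_group) = (x \in power_group).
Proof.
rewrite /diagact; case: ifP => // /andP[Da Rx]; rewrite Rx.
apply/setXnP=> i; rewrite ffunE gact_stable //.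
by move/setXnP: Rx; apply.
Qed.

Lemma diagact_is_action : is_action D diagact.
Proof.
split=> [a x y eq_xy | x a b Da Db]; last first.
  rewrite {2}/diagact diagact_stable /diagact groupM // Da Db /=.
  by case: ifP => // _; apply/ffunP=> i; rewrite !ffunE actMin.
have eqR : (x \in power_group) = (y \in power_group).
  by rewrite -(diagact_stable x a) eq_xy diagact_stable.
move: eq_xy; rewrite /diagact eqR; case: ifP => // _ /ffunP eq_xy.
by apply/ffunP=> i; have:= eq_xy i; rewrite !ffunE => /act_inj.
Qed.

Canonical diag_action := Action diagact_is_action.

Lemma diagact_is_groupAction : is_groupAction power_group diag_action.
Proof.
move=> a Da; rewrite inE; apply/andP; split.
  apply/subsetP=> x; apply: contraR => Rx.
  by rewrite actpermE /= /diagact (negPf Rx) andbF.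
apply/morphicP=> x y Rx Ry; rewrite !actpermE /= /diagact Da.
rewrite groupM // Rx Ry; apply/ffunP=> i; rewrite !ffunE gactM //.
  by move/setXnP: Rx; apply.
by move/setXnP: Ry; apply.
Qed.

Canonical diag_groupAction := GroupAction diagact_is_groupAction.

End DiagonalAction.

(* Main.v *)
Require Import Defs.
From HB Require Import structures.
From mathcomp Require Import all_boot all_fingroup all_solvable.

Set Implicit Arguments.
Unset Strict Implicit.
Unset Printing Implicit Defensive.

Local Open Scope group_scope.

(**
Both classes of groups in the theorem carry an exchange property like that of
linear algebra, and exchange implies replacement.  In V^t ><| H, with H of prime
order and V faithful and irreducible, the field F = End_H(V) makes V a line,
because the abelian group H spans F.  Every subgroup that is not inside V^t is
W ><| <[h]> for some F-subspace W and some h outside V^t, so that generating the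
group amounts to generating V^t over F once one such h has been chosen.  The
proof only uses the following trace of this structure, called [line_group]: a
nonabelian group G with an abelian normal subgroup K of prime index such that
every nontrivial element of K has a minimal normal subgroup of G as its normal
closure.  These normal closures, the lines, replace the one-dimensional
F-subspaces.  [line_set_replacement] derives the replacement property from the
exchange property [line_exchange], [line_group_sdprod] recovers V, t and H from
the lines, and [sdprod_line_group] shows that V^t ><| H is such a group.

Conversely, let G be soluble with the strong replacement property.  Replacing an
entry by an element of a normal subgroup N is the same, modulo N, as deleting
it; hence no generating set of G remains irredundant modulo a nontrivial N
([redundant_mod]).  So a minimal normal subgroup N has a complement M, which
inherits the property ([complement_replacement]) and is known by induction.  If
B is an irredundant generating set of M and some b in B is changed into n * b
with n in N, the new set generates another complement of N
([complement_lift]).  All relations of M therefore survive arbitrary changes of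
this kind, and this determines the action of M on N.  If M is elementary abelian
of rank at least 2, it centralises N ([abelian_complement]).  If M is a line
group over K, then K centralises N ([line_kernel_cent]) and each n * u, with u
nontrivial in K, spans a line isomorphic to that of u, so that G is a line group
over N <*> K ([line_extension]).
*)

(** * Irredundant generating sets *)

Section GeneratingSets.
Variable gT : finGroupType.
Implicit Types (G : {group gT}) (A D J : {set gT}).

Definition irredundant G A :=
  <<A>> = G /\ forall a, a \in A -> <<A :\ a>> <> G.

Definition set_replacement G :=
  forall A, irredundant G A -> forall x, x \in G -> x != 1 ->
  exists2 a, a \in A & <<x |: A :\ a>> = G.

(** Irredundance forces the entries of a generating sequence to be distinct, so
such sequences are the enumerations of irredundant generating sets. *)
Lemma set_replacementP G : strong_replacement_property G <-> set_replacement G.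
Proof.
split=> [srG A [genA irrA] x Gx ntx | srG n g [genA irrA] x Gx ntx].
  pose g (i : 'I_#|A|) := enum_val i.
  have imA : g @: [set: 'I_#|A|] = A.
    apply/setP=> a; apply/imsetP/idP=> [[i _ ->] | Aa]; first exact: enum_valP.
    by exists (enum_rank_in Aa a); rewrite ?inE // /g enum_rankK_in.
  have [|i] := srG _ g _ x Gx ntx.
    split=> [|J /properP[_ [i _ notJi]]]; first by rewrite /generating imA.
    have sJA: g @: J \subset A by apply/subsetP=> _ /imsetP[j _ ->]; apply: enum_valP.
    rewrite properE -{1}genA (genS sJA) /=.
    apply/negP=> sGJ; case: (irrA (g i) (enum_valP i)); apply/eqP.
    rewrite eqEsubset -{1}genA genS ?subsetDl //=.
    apply: subset_trans sGJ _; apply: genS; apply/subsetP=> _ /imsetP[j Jj ->].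
    rewrite !inE enum_valP andbT (inj_eq enum_val_inj).
    by apply: contraNneq notJi => <-.
  rewrite /generating => genx; exists (g i); first exact: enum_valP.
  apply/eqP; rewrite eqEsubset gen_subG subUset sub1set Gx /=.
  rewrite -{1}genA (subset_trans (subsetDl _ _) (subset_gen _)) /=.
  rewrite -{1}genx; apply: genS; apply/subsetP=> _ /imsetP[j _ ->].
  rewrite /= !inE; case: (eqVneq j i) => [_ | neq_ji]; first by rewrite eqxx.
  by rewrite enum_valP (inj_eq enum_val_inj) neq_ji orbT.
have injg i j : g i = g j -> i = j.
  move=> eq_gij; apply/eqP; apply/idPn=> neq_ij.
  have: [set~ i] \proper [set: 'I_n].
    by rewrite properE subsetT; apply/subsetPn; exists i; rewrite !inE ?eqxx.
  case/irrA/proper_neq/eqP; rewrite -genA; congr <<_>>.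
  apply/setP=> a; apply/imsetP/imsetP=> [[k _ ->] | [k _ ->]]; first by exists k.
  have [-> | neq_ki] := eqVneq k i; last by exists k; rewrite ?inE.
  by exists j; rewrite // !inE eq_sym.
have [|_ /imsetP[i _ ->] genx] := srG (g @: [set: 'I_n]) _ x Gx ntx.
  split=> // _ /imsetP[i _ ->].
  have /irrA/proper_neq/eqP: [set~ i] \proper [set: 'I_n].
    by rewrite properE subsetT; apply/subsetPn; exists i; rewrite !inE ?eqxx.
  move=> neq eqG; case: neq; rewrite -eqG; congr <<_>>.
  apply/setP=> a; rewrite !inE; apply/imsetP/andP=> [[j neq_ji ->]|].
    split; last exact: imset_f.
    by apply: contraTneq neq_ji => /injg->; rewrite !inE eqxx.
  case=> neq /imsetP[j _ eqa]; exists j; rewrite // !inE.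
  by apply: contraNneq neq => <-; apply/eqP.
exists i; rewrite /generating -genx; congr <<_>>.
apply/setP=> a; rewrite !inE; apply/imsetP/idP=> [[j _ ->] /= | ].
  case: (eqVneq j i) => [_ | neq_ji]; first by rewrite eqxx.
  rewrite imset_f // andbT orbC; apply/orP; left.
  by apply: contraNneq neq_ji => /injg->.
case/orP=> [/eqP-> | /andP[neq /imsetP[j _ eqa]]].
  by exists i; rewrite ?inE //= eqxx.
by exists j; rewrite ?inE //= ifN //; apply: contraNneq neq => <-; apply/eqP.
Qed.

(** The members of a given set [J0] are kept even if they are redundant; this
makes it possible to prescribe part of a generating set. *)
Lemma exists_irredundant_sub G J0 A :
  <<J0 :|: A>> = G ->
  exists D, [/\ D \subset A, <<J0 :|: D>> = G &
     forall a, a \in D -> <<J0 :|: D :\ a>> <> G].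
Proof.
move=> genA; pose P D := <<J0 :|: D>> == G.
have [D /minsetP[/eqP genD minD] sDA]: {D | minset P D & D \subset A}.
  by apply: minset_exists; apply/eqP.
exists D; split=> // a Da /eqP/minD/(_ (subsetDl _ _))/setP/(_ a).
by rewrite !inE eqxx Da.
Qed.

Lemma exists_irredundant G : exists A, irredundant G A.
Proof.
have [|D [_ genD irrD]] := @exists_irredundant_sub G set0 G.
  by rewrite set0U genGid.
exists D; split=> [|a Da]; first by rewrite -genD set0U.
by move: (irrD a Da); rewrite set0U.
Qed.

(** In a set J with J0 \subset J \subset A that is minimal for x \in <<J>>, each
member outside J0 can be exchanged for x. *)
Lemma exchange_replacement G J0 A x :
    <<A>> = G -> J0 \subset A -> x \in G -> x \notin <<J0>> ->
    (forall J a, J0 \subset J -> J \subset G -> a \in G ->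
       x \in <<a |: J>> -> x \notin <<J>> -> a \in <<x |: J>>) ->
  exists2 a, a \in A :\: J0 & <<x |: A :\ a>> = G.
Proof.
move=> genA sJ0A Gx notJ0x exch.
have sAG: A \subset G by rewrite -genA subset_gen.
pose P J := (J0 \subset J) && (x \in <<J>>).
have [J /minsetP[/andP[sJ0 Jx] minJ] sJA]: {J | minset P J & J \subset A}.
  by apply: minset_exists; rewrite /P sJ0A genA.
have /subsetPn[a Ja notJ0a]: ~~ (J \subset J0).
  by apply: contra notJ0x => sJJ0; apply: subsetP Jx; apply: genS.
have Aa := subsetP sJA a Ja.
exists a; first by rewrite inE notJ0a.
have sJ0a: J0 \subset J :\ a by rewrite subsetD1 sJ0.
have: a \in <<x |: J :\ a>>.
  apply: exch; rewrite ?setD1K //.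
  - by rewrite (subset_trans (subsetDl _ _)) ?(subset_trans sJA).
  - exact: subsetP Aa.
  apply/negP=> Jax; have /minJ/(_ (subsetDl _ _))/setP/(_ a) : P (J :\ a).
    by rewrite /P sJ0a.
  by rewrite !inE eqxx Ja.
move=> ax; apply/eqP; rewrite eqEsubset gen_subG subUset sub1set Gx /=.
rewrite (subset_trans (subsetDl _ _) sAG) /= -{1}genA gen_subG.
apply/subsetP=> b Ab; have [-> | neq_ba] := eqVneq b a.
  by apply: subsetP ax; apply: genS; apply: setUS; apply: setSD.
by rewrite mem_gen // !inE neq_ba Ab orbT.
Qed.

End GeneratingSets.

(** * Exchange in elementary abelian groups *)

Section Exchange.
Variable gT : finGroupType.
Implicit Types (E : {group gT}) (A J : {set gT}).

Lemma mem_cycle_expg (a : gT) i p :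
  prime p -> a ^+ p = 1 -> a ^+ i != 1 -> a \in <[a ^+ i]>.
Proof.
move=> p_pr ap1 nt_ai; rewrite -cycle_subG prime_meetG //.
  suff /eqP-> : #|<[a]>| == p by [].
  have/primeP[_/(_ #[a])] := p_pr; rewrite order_dvdn ap1 eqxx => /(_ isT).
  case/orP=> //; rewrite order_eq1 => /eqP a1.
  by rewrite a1 expg1n eqxx in nt_ai.
apply/trivgPn; exists (a ^+ i) => //.
by rewrite inE mem_cycle cycle_id.
Qed.

Lemma abelem_exchange p E J a x :
    p.-abelem E -> prime p -> J \subset E -> a \in E ->
  x \in <<a |: J>> -> x \notin <<J>> -> a \in <<x |: J>>.
Proof.
move=> abelE p_pr sJE Ea; have [cEE Ep] := abelemP p_pr abelE.
have cJa: <<J>> \subset 'C(<[a]>).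
  by rewrite gen_subG (centsS _ (subset_trans sJE cEE)) // cycle_subG.
rewrite setUC -joingE -joing_idl -joing_idr cent_joinEl //.
case/mulsgP=> y _ Jy /cycleP[i ->] -> notJ.
have: a \in <[a ^+ i]>.
  apply: mem_cycle_expg p_pr (Ep a Ea) _.
  by apply: contraNneq notJ => ->; rewrite mulg1.
apply: subsetP; rewrite cycle_subG -{1}[a ^+ i](mulKg y) groupM //.
  by rewrite groupV; apply: subsetP Jy; apply: genS; apply: subsetUr.
by rewrite mem_gen // setU11.
Qed.

Lemma abelem_replacement p E : prime p -> p.-abelem E -> set_replacement E.
Proof.
move=> p_pr abelE A [genA _] x Ex ntx.
have [|J a _ sJE Ea xaJ notJx|a] := exchange_replacement genA (sub0set A) Ex.
- by rewrite gen0 inE.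
- exact: abelem_exchange abelE p_pr sJE Ea xaJ notJx.
by rewrite setD0; exists a.
Qed.

End Exchange.

(** * Groups whose minimal normal subgroups are the lines of a module *)

Section LineGroups.
Variable gT : finGroupType.
Implicit Types (C G H K M U Z : {group gT}) (A B D J : {set gT}).

(** The model is G = V^t ><| H over K = V^t, for H of prime order and V faithful
and irreducible: the subgroups <<v ^: G>> are then the lines of K as a vector
space over End_H(V).  Without the condition that G is nonabelian, K could be
central. *)
Definition line_group G K :=
  [/\ K <| G, abelian K, prime #|G : K|, ~~ abelian G
    & forall v, v \in K -> v != 1 -> minnormal <<v ^: G>> G].

Lemma class_gen_norm G (v : gT) : G \subset 'N(<<v ^: G>>).
Proof. by rewrite norms_gen ?class_norm. Qed.

Lemma class_gen_id G (v : gT) : v \in <<v ^: G>>.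
Proof. by rewrite mem_gen ?class_refl. Qed.

Lemma class_gen_sub G H (v : gT) :
  G \subset 'N(H) -> (<<v ^: G>> \subset H) = (v \in H).
Proof. by move=> nHG; rewrite gen_subG class_sub_norm. Qed.

Section LineGroup.

Variables (G K : {group gT}).
Hypothesis lineGK : line_group G K.

Let nsKG : K <| G. Proof. by case: lineGK. Qed.
Let abK : abelian K. Proof. by case: lineGK. Qed.
Let pr_GK : prime #|G : K|. Proof. by case: lineGK. Qed.
Let not_abG : ~~ abelian G. Proof. by case: lineGK. Qed.
Let minV v : v \in K -> v != 1 -> minnormal <<v ^: G>> G.
Proof. by case: lineGK => _ _ _ _; apply. Qed.
Let sKG : K \subset G. Proof. exact: normal_sub. Qed.
Let nKG : G \subset 'N(K). Proof. exact: normal_norm. Qed.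

Lemma line_eq v Z : v \in K -> v != 1 -> G \subset 'N(Z) -> Z :!=: 1 ->
  Z \subset <<v ^: G>> -> Z :=: <<v ^: G>>.
Proof.
move=> Kv ntv nZG ntZ sZV; case/mingroupP: (minV Kv ntv) => _; apply => //.
by rewrite ntZ.
Qed.

(** Lines are minimal normal, so a normal subgroup contains each line that it
meets nontrivially. *)
Lemma line_meet v Z : v \in K -> v != 1 -> G \subset 'N(Z) ->
  Z :&: <<v ^: G>> != 1 -> v \in Z.
Proof.
move=> Kv ntv nZG ntZ; rewrite -(class_gen_sub _ nZG).
have nIG : G \subset 'N(Z :&: <<v ^: G>>) by rewrite normsI ?class_gen_norm.
by rewrite -(line_eq Kv ntv nIG ntZ (subsetIr _ _)) subsetIl.
Qed.

Lemma line_mulG U : U \subset G -> ~~ (U \subset K) -> K * U = G.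
Proof.
move=> sUG not_sUK; have maxK: maximal K G by apply: p_index_maximal.
exact: mulg_normal_maximal.
Qed.

(** Suppose that z is central and nontrivial, and let u in K be noncentral.  The
lines of u and of u * z share the commutators [~ u, g], so they coincide and
contain z, whose line is <[z]>; then u lies in <[z]> and is central. *)
Lemma line_center z : z \in K -> z \in 'Z(G) -> z = 1.
Proof.
move=> Kz Zz; apply/eqP/idPn=> ntz; have [Gz cGz] := centerP G z Zz.
have /subsetPn[u Ku notZu]: ~~ (K \subset 'Z(G)).
  apply: contra not_abG => sKZ; apply: cyclic_factor_abelian sKZ _.
  by rewrite prime_cyclic // card_quotient.
have Gu := subsetP sKG u Ku.
have ntu: u != 1 by apply: contraNneq notZu => ->; apply: group1.
have [g Gg ntug]: exists2 g, g \in G & [~ u, g] != 1.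
  move: notZu; rewrite inE Gu /= => /centP cGu.
  apply/exists_inP; apply: contra_notT cGu.
  rewrite negb_exists_in => /forall_inP cGu g Gg.
  by apply/commgP; rewrite -[_ == _]negbK cGu.
have ntuz: u * z != 1.
  apply: contraNneq notZu => /(canRL (mulgK z))->.
  by rewrite mul1g groupV.
have: u * z \in <<u ^: G>>.
  apply: (line_meet (groupM Ku Kz) ntuz (class_gen_norm _ _)).
  apply/trivgPn; exists [~ u, g] => //; rewrite inE; apply/andP; split.
    by rewrite commgEl groupM ?groupV ?class_gen_id // mem_gen ?memJ_class.
  have <-: [~ u * z, g] = [~ u, g].
    rewrite commMgJ; suff ->: [~ z, g] = 1 by rewrite mulg1 conjgE -cGz ?mulKg ?groupR.
    by apply/eqP/commgP; apply: cGz.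
  by rewrite commgEl groupM ?groupV ?class_gen_id // mem_gen ?memJ_class.
rewrite groupMl ?class_gen_id // => Vz.
have: u \in <[z]>.
  apply: (line_meet Ku ntu).
    by rewrite cents_norm // centsC cycle_subG; apply/centP; apply: cGz.
  by apply/trivgPn; exists z; rewrite // inE cycle_id.
by case/cycleP=> i def_u; rewrite def_u groupX in notZu.
Qed.

(** An element of K :&: <[h]> commutes with K and with h, hence is central. *)
Lemma line_complement h : h \in G -> h \notin K ->
  [/\ K * <[h]> = G, K :&: <[h]> = 1 & #[h] = #|G : K|].
Proof.
move=> Gh notKh; have defG: K * <[h]> = G.
  by apply: line_mulG; rewrite cycle_subG.
have tiKh: K :&: <[h]> = 1.
  apply/trivgP/subsetP=> z /setIP[Kz hz]; rewrite inE; apply/eqP.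
  apply: line_center => //; rewrite inE (subsetP sKG) //= -defG.
  rewrite centM inE (subsetP abK) //=.
  by apply: subsetP hz; apply: cycle_abelian.
split=> //; apply/eqP; rewrite -(eqn_pmul2l (cardG_gt0 K)) Lagrange //.
by rewrite -TI_cardMg ?defG.
Qed.

(** Since K * U = G, only the K-parts v of y and w of x matter.  The group
K :&: U is normal in G and w lies in the product of K :&: U with the line of v;
as this line is minimal, v lies in the product of K :&: U with the line of w. *)
Lemma line_exchange U x y :
    U \subset G -> ~~ (U \subset K) -> x \in G -> y \in G ->
  x \in <<y |: U>> -> x \notin U -> y \in <<x |: U>>.
Proof.
move=> sUG not_sUK Gx Gy yUx notUx.
have defG := line_mulG sUG not_sUK.
have nIG: G \subset 'N(K :&: U).
  rewrite -defG mulG_subG andbC normsI ?normG ?(subset_trans sUG) //=.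
  by rewrite cents_norm // (subset_trans abK) // centS ?subsetIl.
move: (Gx) (Gy); rewrite -defG => /mulsgP[w a Kw Ua def_x] /mulsgP[v b Kv Ub def_y].
have notUw: w \notin U by apply: contra notUx; rewrite def_x groupMr.
have ntw: w != 1 by apply: contraNneq notUw => ->.
have nVU u : U \subset 'N(<<u ^: G>>) by apply: subset_trans (class_gen_norm G u).
have sVK u: u \in K -> <<u ^: G>> \subset K by rewrite class_gen_sub.
have sVU u: u \in K -> <<u ^: G>> \subset <<u |: U>>.
  move=> Ku; have sUu: U \subset <<u |: U>> by rewrite sub_gen ?subsetUr.
  rewrite gen_subG -defG; apply/subsetP=> _ /imsetP[_ /mulsgP[k c Kk Uc ->] ->].
  rewrite conjgM /conjg (centsP abK _ Ku _ Kk) mulKg.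
  have uUc := subsetP sUu c Uc.
  by rewrite !groupM ?groupV // mem_gen ?setU11.
have: w \in <<v ^: G>> * (K :&: U).
  have: x \in <<v ^: G>> * U.
    rewrite -(norm_joinEr (nVU v)); apply: subsetP yUx.
    rewrite gen_subG subUset joing_subr sub1set def_y andbT.
    by rewrite groupM ?mem_gen // inE ?class_gen_id ?Ub ?orbT.
  rewrite setIC group_modl ?sVK // inE def_x Kw !andbT.
  case/mulsgP=> s c Vs Uc def; apply/mulsgP; exists s (c * a^-1) => //.
    by rewrite groupM ?groupV.
  by rewrite mulgA -def mulgK.
case/mulsgP=> s c Vs /setIP[Kc Uc] def_w.
have Zs: s \in <<w ^: G>> * (K :&: U).
  by apply/mulsgP; exists w c^-1; rewrite ?class_gen_id ?inE ?groupV ?Kc // def_w mulgK.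
have nts: s != 1.
  by apply: contraNneq notUw => s1; rewrite def_w s1 mul1g.
have ntv: v != 1.
  apply: contraNneq nts => v1; move: Vs.
  by rewrite v1 class1G gen_set_id ?group_set_one ?inE.
have: v \in <<w ^: G>> <*> (K :&: U).
  apply: (line_meet Kv ntv).
    by rewrite normsY ?class_gen_norm.
  apply/trivgPn; exists s => //; rewrite inE Vs andbT /=.
  by rewrite norm_joinEr; [exact: Zs | exact: subset_trans (subsetIr K U) (nVU w)].
have /subsetP sUx : U \subset <<x |: U>> by rewrite sub_gen ?subsetUr.
have sVx: <<w ^: G>> <*> (K :&: U) \subset <<x |: U>>.
  rewrite join_subG (subset_trans (subsetIr _ _)) ?andbT; last by apply/subsetP.
  apply: subset_trans (sVU w Kw) _; rewrite gen_subG subUset; apply/andP.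
  split; last by apply/subsetP.
  have xUx: x \in <<x |: U>> by rewrite mem_gen ?setU11.
  by rewrite sub1set (canRL (mulgK a) (esym def_x)) groupM // groupV sUx.
by move/(subsetP sVx) => vx; rewrite def_y groupM // sUx.
Qed.

(** Exchange is only available above a subgroup not contained in K, which is why
a fixed g outside K has to be kept. *)
Lemma line_replacement A g x : g \in A -> g \notin K -> <<A>> = G ->
    x \in G -> x \notin <[g]> ->
  exists a, [/\ a \in A, a != g & <<x |: A :\ a>> = G].
Proof.
move=> Ag notKg genA Gx notgx.
have sgA: [set g] \subset A by rewrite sub1set.
have [J a sgJ sJG Ga xaJ notJx | a] := exchange_replacement genA sgA Gx notgx.
  have sJgen : J \subset <<J>> by apply: subset_gen.
  rewrite -joingE -joing_idr joingE; apply: line_exchange => //=.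
  - by rewrite gen_subG.
  - by apply: contra notKg; rewrite gen_subG => /subsetP-> //; rewrite -sub1set.
  by rewrite -joingE joing_idr.
by rewrite !inE => /andP[neq Aa] gen; exists a.
Qed.

(** Only powers of g cannot replace another member of the generating set; they
replace g itself since <[g]> has prime order. *)
Lemma line_set_replacement : set_replacement G.
Proof.
move=> A [genA _] x Gx ntx.
have /subsetPn[g Ag notKg]: ~~ (A \subset K).
  rewrite -gen_subG genA; apply: contra not_abG => sGK.
  exact: abelianS sGK abK.
have Gg: g \in G by rewrite -genA mem_gen.
have [_ _ og] := line_complement Gg notKg.
have [/cycleP[i def_x] | notgx] := boolP (x \in <[g]>); last first.
  by have [a [Aa _ gen]] := line_replacement Ag notKg genA Gx notgx; exists a.
have gx: g \in <[x]>.
  by rewrite def_x (mem_cycle_expg pr_GK) -?og ?expg_order // -def_x.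
exists g => //; apply/eqP; rewrite eqEsubset gen_subG subUset sub1set Gx /=.
have sAG: A \subset G by rewrite -genA subset_gen.
rewrite (subset_trans (subsetDl _ _) sAG) /= -{1}genA gen_subG.
apply/subsetP=> b Ab; have [-> | neq_bg] := eqVneq b g.
  by apply: subsetP gx; apply: genS; apply: subsetUl.
by rewrite mem_gen // !inE neq_bg Ab orbT.
Qed.

End LineGroup.
(** A minimal choice of further members inside K does it: if w were redundant,
exchanging it for one of them would contradict minimality. *)
Lemma line_irredundant M K h w : line_group M K ->
    h \in M -> h \notin K -> w \in K -> w != 1 ->
  exists B, [/\ irredundant M B, h \in B & w \in B].
Proof.
move=> lineMK Mh notKh Kw ntw; have [nsKM abK _ _ _] := lineMK.
have sKM := normal_sub nsKM; have Mw := subsetP sKM w Kw.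
have [defM tiKh _] := line_complement lineMK Mh notKh.
have notKM: ~~ (M \subset K) by apply/subsetPn; exists h.
pose C := [set h; w].
have Ch: h \in C by rewrite !inE eqxx.
have Cw: w \in C by rewrite !inE eqxx orbT.
have sCM: C \subset M by rewrite subUset !sub1set Mh.
have [|D [sDK genCD irrD]] := @exists_irredundant_sub _ M C K.
  apply/eqP; rewrite eqEsubset gen_subG subUset sCM sKM /= -{1}defM.
  rewrite mul_subG //; first by rewrite sub_gen ?subsetUr.
  by rewrite genS // sub1set inE Ch.
exists (C :|: D); split; try by rewrite inE ?Ch ?Cw.
split=> // a CDa gena.
have irr a' (X : {set gT}) : a' \in D -> X \subset C :|: D :\ a' -> <<X>> <> M.
  move=> Da' sX genX; case: (irrD a' Da'); apply/eqP; rewrite eqEsubset.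
  rewrite -{2}genX (genS sX) gen_subG subUset sCM /= andbT.
  by rewrite (subset_trans (subsetDl _ _)) ?(subset_trans sDK).
have [Da | notDa] := boolP (a \in D).
  by apply: (irr a _ Da _ gena); rewrite setDUl setSU // subsetDl.
have [def_a | neq_ah] := eqVneq a h.
  case/negP: notKM; rewrite -gena gen_subG def_a; apply/subsetP=> b.
  rewrite !inE => /andP[/negPf->] /= /orP[/eqP-> // | ].
  exact: (subsetP sDK).
have def_a: a = w.
  by move: CDa; rewrite !inE (negPf notDa) (negPf neq_ah) orbF => /eqP.
have Eh: h \in (C :|: D) :\ a by rewrite !inE eq_sym neq_ah eqxx.
have notHw: w \notin <[h]>.
  by apply: contra ntw => hw; rewrite -in_set1 -[[set 1]]tiKh inE Kw.
have [b [Eb neq_bh genb]] := line_replacement lineMK Eh notKh gena Mw notHw.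
move: Eb; rewrite def_a !inE (negPf neq_bh) /= => /andP[/negPf neq_bw].
rewrite neq_bw /= => Db; apply: (irr b _ Db _ genb); apply/subsetP=> c.
rewrite def_a !inE; case: (c == w) => /=; first by rewrite orbT.
by case: (c == h) => /=.
Qed.

(** For h outside K, both h and h * w have order #|M : K|, and (h * w) ^+ k is
h ^+ k times the product of the w ^ (h ^+ i) for i < k, in decreasing order of
i.  At k = #[h] this writes w as the inverse of a product of outer conjugates. *)
Lemma line_outer_conj M K C w : line_group M K -> w \in K ->
  (forall g, g \in M -> g \notin K -> w ^ g \in C) -> w \in C.
Proof.
move=> lineMK Kw Cw; have [nsKM abK pr_MK not_abM _] := lineMK.
have [sKM nKM] := andP nsKM; have Mw := subsetP sKM w Kw.
have /subsetPn[h Mh notKh]: ~~ (M \subset K).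
  by apply: contra not_abM => sMK; apply: abelianS sMK abK.
have [_ tiKh oh] := line_complement lineMK Mh notKh.
have notKhw: h * w \notin K by rewrite groupMr.
have [_ _ ohw] := line_complement lineMK (groupM Mh Mw) notKhw.
have notKhk k : 0 < k -> k < #[h] -> h ^+ k \notin K.
  move=> k_gt0 lt_k_h; apply/negP=> Khk.
  have /eqP: h ^+ k = 1.
    by apply/eqP; rewrite -in_set1 -[[set 1]]tiKh inE Khk mem_cycle.
  by rewrite -order_dvdn gtnNdvd.
have pow k : k < #[h] -> exists2 c, c \in C & (h * w) ^+ k.+1 = h ^+ k.+1 * (c * w).
  elim: k => [|k IHk] lt_k_h; first by exists 1; rewrite ?group1 // !expg1 mul1g.
  have [c Cc def_c] := IHk (ltnW lt_k_h).
  exists (w ^ (h ^+ k.+1) * c).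
    by rewrite groupM // Cw ?notKhk ?groupX.
  by rewrite expgS def_c conjgE (expgS h k.+1) -!mulgA mulKVg.
have h_gt0 := order_gt0 h.
have [|c Cc] := pow #[h].-1; first by rewrite prednK.
rewrite prednK // {1}oh -ohw !expg_order mul1g => /esym/(canRL (mulKg c))->.
by rewrite mulg1 groupV.
Qed.

End LineGroups.

(** * Soluble groups with the replacement property *)

Section Structure.
Variable gT : finGroupType.
Implicit Types (G K L M N Z : {group gT}) (A B D : {set gT}).

(** A nontrivial element of N can replace some member a of A, and this does not
change the subgroup that A :\ a generates modulo N. *)
Lemma redundant_mod G N A :
    set_replacement G -> N <| G -> N :!=: 1 -> <<A>> = G ->
  exists2 a, a \in A & N * <<A :\ a>> = G.
Proof.
move=> srG nsNG ntN genA; have [sNG nNG] := andP nsNG.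
have sAG: A \subset G by rewrite -genA subset_gen.
have sAaG a: <<A :\ a>> \subset G by rewrite gen_subG (subset_trans (subsetDl _ _)).
have [/exists_inP[a Aa /eqP]|] := boolP [exists a in A, N * <<A :\ a>> == G].
  by exists a.
rewrite negb_exists_in => /forall_inP irrA.
have [x Nx ntx] := trivgPn _ ntN; have Gx := subsetP sNG x Nx.
have [|a Aa genx] := srG A _ x Gx ntx.
  split=> // a Aa gena; case/eqP: (irrA a Aa).
  by rewrite gena mulSGid.
case/eqP: (irrA a Aa); apply/eqP; rewrite eqEsubset mul_subG //= -{1}genx.
rewrite -norm_joinEr ?(subset_trans (sAaG a)) // gen_subG subUset sub1set.
by rewrite (subsetP (joing_subl _ _)) // sub_gen // subsetU // subset_gen orbT.
Qed.

Section Complement.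

Variables (G N M : {group gT}).
Hypotheses (srG : set_replacement G) (minN : minnormal N G) (abN : abelian N).
Hypotheses (defG : N * M = G) (tiNM : N :&: M = 1).

Let sNG : N \subset G. Proof. by rewrite -defG mulG_subl. Qed.
Let sMG : M \subset G. Proof. by rewrite -defG mulG_subr. Qed.
Let nNG : G \subset 'N(N). Proof. by case/mingroupP: minN => /andP[]. Qed.
Let ntN : N :!=: 1. Proof. by case/mingroupP: minN => /andP[]. Qed.
Let nsNG : N <| G. Proof. exact/andP. Qed.

Lemma minnormal_meet L : N * L = G -> N :&: L = 1 \/ N \subset L.
Proof.
move=> defNL; have [-> | ntI] := eqVneq (N :&: L) 1; [by left | right].
case/mingroupP: minN => _ min; rewrite -(min (N :&: L)%G) ?subsetIl ?subsetIr //=.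
have sLG: L \subset G by rewrite -defNL mulG_subr.
rewrite ntI /= -defNL mulG_subG andbC normsI ?normG ?(subset_trans sLG) //=.
by rewrite cents_norm // (subset_trans abN) // centS ?subsetIl.
Qed.

Lemma complement_gen B : B \subset M -> N * <<B>> = G -> <<B>> = M.
Proof.
move=> sBM defNB; apply/eqP; rewrite eqEsubset gen_subG sBM /=.
have sB: <<B>> \subset M by rewrite gen_subG.
by rewrite -(mul1g <<B>>) -tiNM setIC group_modr // subsetI subxx defNB.
Qed.

(** Adding v in N to an irredundant generating set of M gives one for G.  In it,
an element of M cannot replace v, and any other replacement can be read
modulo N. *)
Lemma complement_replacement : set_replacement M.
Proof.
move=> A [genA irrA] x Mx ntx; have [v Nv ntv] := trivgPn _ ntN.
have sAM: A \subset M by rewrite -genA subset_gen.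
have notMv: v \notin M.
  by apply: contra ntv => Mv; rewrite -in_set1 -[[set 1]]tiNM inE Nv.
have notAv: v \notin A by apply: contra notMv; apply: (subsetP sAM).
have genvA: <<v |: A>> = G.
  have sMvA: M \subset <<v |: A>> by rewrite -{1}genA genS ?subsetUr.
  have svAG: <<v |: A>> \subset G.
    by rewrite gen_subG subUset sub1set (subsetP sNG) ?(subset_trans sAM).
  have defNvA: N * <<v |: A>> = G.
    by apply/eqP; rewrite eqEsubset mul_subG //= -{1}defG mulgS.
  case: (minnormal_meet defNvA) => [tiNvA | sNvA].
    case/negP: ntv; rewrite -in_set1 -[[set 1]]tiNvA inE Nv.
    by rewrite mem_gen ?setU11.
  by apply/eqP; rewrite eqEsubset svAG /= -{1}defG mul_subG.
have defvA a : a \in A -> (v |: A) :\ a = v |: A :\ a.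
  move=> Aa; rewrite setDUl; congr (_ :|: _); apply/setDidPl.
  by rewrite disjoints1 inE; apply: contraNneq notAv => ->.
have genD a B : a \in A -> B \subset M ->
    <<v |: B>> = G -> <<B>> = M.
  move=> Aa sBM gen; apply: complement_gen => //.
  have sBG: <<B>> \subset G by rewrite gen_subG (subset_trans sBM).
  apply/eqP; rewrite eqEsubset mul_subG //= -{1}gen.
  rewrite -norm_joinEr ?(subset_trans sBG) // gen_subG subUset sub1set.
  by rewrite (subsetP (joing_subl _ _)) // sub_gen // subsetU // subset_gen orbT.
have sAaM a : A :\ a \subset M by rewrite (subset_trans (subsetDl _ _)).
have [|a] := @srG (v |: A) _ x (subsetP sMG x Mx) ntx.
  split; first exact: genvA.
  move=> a /setU1P[-> | Aa gena]; last first.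
    by case: (irrA a Aa); apply: (genD a) => //; rewrite -defvA.
  rewrite setU1K // genA => eqMG; case/negP: notMv.
  by rewrite eqMG (subsetP sNG).
case/setU1P=> [-> | Aa gen].
  rewrite setU1K // => gen; case/negP: notMv.
  have sGM: G \subset M by rewrite -gen gen_subG subUset sub1set Mx.
  by rewrite (subsetP sGM) ?(subsetP sNG).
exists a => //; apply: (genD a) => //; first by rewrite subUset sub1set Mx sAaM.
by rewrite setUCA -defvA.
Qed.

(** Modulo N the new set is B, so it is irredundant modulo N and cannot generate
G by [redundant_mod]; as it supplements the minimal normal subgroup N, it
generates a complement. *)
Lemma complement_lift B b n : irredundant M B -> b \in B -> n \in N ->
  N :&: <<n * b |: B :\ b>> = 1.
Proof.
move=> [genB irrB] Bb Nn; set A := _ |: _.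
have sBM: B \subset M by rewrite -genB subset_gen.
have sAG: <<A>> \subset G.
  rewrite gen_subG subUset sub1set groupM ?(subsetP sNG n) //=.
    by rewrite (subset_trans (subsetDl _ _)) ?(subset_trans sBM).
  by rewrite (subsetP sMG) ?(subsetP sBM).
have nNA: <<A>> \subset 'N(N) by apply: subset_trans nNG.
have sBaG a : <<B :\ a>> \subset G.
  by rewrite gen_subG (subset_trans (subsetDl _ _)) ?(subset_trans sBM).
have nNBa a : <<B :\ a>> \subset 'N(N) by apply: subset_trans nNG.
have irrN D a : a \in B -> D \subset N <*> <<B :\ a>> -> N * <<D>> <> G.
  move=> Ba sD defND; case: (irrB a Ba); apply: complement_gen.
    by rewrite (subset_trans (subsetDl _ _)).
  apply/eqP; rewrite eqEsubset mul_subG //= -norm_joinEr ?nNBa //.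
  by rewrite -{1}defND mul_subG ?joing_subl ?gen_subG.
have defNA: N * <<A>> = G.
  apply/eqP; rewrite eqEsubset mul_subG //= -norm_joinEr // -{1}defG -genB.
  rewrite mul_subG ?joing_subl // gen_subG; apply/subsetP=> c Bc.
  have sA: A \subset N <*> <<A>> by rewrite sub_gen // subsetU // subset_gen orbT.
  have [-> | neq_cb] := eqVneq c b.
    rewrite -(mulKg n b) groupM //; last by rewrite (subsetP sA) ?setU11.
    by rewrite groupV (subsetP (joing_subl _ _)).
  by rewrite (subsetP sA) // !inE neq_cb Bc orbT.
case: (minnormal_meet defNA) => [-> // | sNA].
have genA: <<A>> = G.
  by rewrite -[LHS](mulSGid sNA).
have [a Aa defNAa] := redundant_mod srG nsNG ntN genA.
case: (@irrN (A :\ a) (if a == n * b then b else a)) => //.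
  by case: eqP => // /eqP neq; move: Aa; rewrite !inE (negPf neq) => /andP[].
apply/subsetP=> c; rewrite 2!inE => /andP[neq_ca].
have [def_a | neq_a] := eqVneq a (n * b).
  rewrite /A in_setU1 -def_a (negPf neq_ca) => Bc.
  by rewrite (subsetP (joing_subr _ _)) // mem_gen.
rewrite /A in_setU1 => /predU1P[-> | /setD1P[_ Bc]]; last first.
  by rewrite (subsetP (joing_subr _ _)) // mem_gen // !inE neq_ca.
rewrite groupM ?(subsetP (joing_subl _ _) n) //.
rewrite (subsetP (joing_subr _ _)) // mem_gen // !inE Bb andbT.
by move: Aa; rewrite !inE (negPf neq_a) eq_sym => /andP[].
Qed.

Let nNM : M \subset 'N(N). Proof. exact: subset_trans nNG. Qed.

Let minN_eq Z : G \subset 'N(Z) -> Z :!=: 1 -> Z \subset N -> Z :=: N.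
Proof. by move=> nZG ntZ; case/mingroupP: minN => _; apply; rewrite ntZ. Qed.

(** Every complement of N is abelian of exponent p.  For b != b' in B, a complement
contains b and n * b', so b commutes with n.  If G is not abelian, this leaves a
single member in B, and then N is the only line.  If G is abelian, the complement
containing n * b shows that n has exponent p. *)
Lemma abelian_complement p :
    prime p -> p.-abelem M -> is_abelem N ->
  (exists2 q : nat, prime q & q.-abelem G) \/ (exists K, line_group G K).
Proof.
move=> p_pr abelM /is_abelemP abelN; have [abM Mp] := abelemP p_pr abelM.
have [M1 | ntM] := eqsVneq M 1.
  by left; case: abelN => q q_pr abelN; exists q; rewrite // -defG M1 mulg1.
have [B irrB] := exists_irredundant M; have [genB _] := irrB.
have sBM: B \subset M by rewrite -genB subset_gen.
have [abG | not_abG] := boolP (abelian G).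
  left; exists p => //; apply/(abelemP p_pr); split=> // x Gx.
  have [b Bb]: exists b, b \in B.
    apply/set0Pn; apply: contraNneq ntM => B0.
    by rewrite -genB B0 gen0.
  have cGG y z : y \in G -> z \in G -> commute y z.
    by move=> Gy Gz; apply: (centsP abG).
  have Np n : n \in N -> n ^+ p = 1.
    move=> Nn; have Gn := subsetP sNG n Nn.
    have Gb := subsetP (subset_trans sBM sMG) b Bb.
    apply/eqP; rewrite -in_set1 -[[set 1]](complement_lift irrB Bb Nn).
    rewrite inE groupX //= -[n ^+ p]mulg1 -(Mp b) ?(subsetP sBM) //.
    by rewrite -expgMn ?groupX ?mem_gen ?setU11 //; apply: cGG.
  move: Gx; rewrite -defG => /mulsgP[n m Nn Mm ->].
  have cnm: commute n m by apply: cGG; [apply: (subsetP sNG) | apply: (subsetP sMG)].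
  by rewrite (expgMn p cnm) (Np n Nn) (Mp m Mm) mulg1.
right; exists N; have cBN b b' : b \in B -> b' \in B -> b' != b -> b \in 'C(N).
  move=> Bb Bb' neq_b; apply/centP=> n Nn; apply/esym/commgP.
  rewrite -(conjg_eq1 _ b') -in_set1 -[[set 1]](complement_lift irrB Bb' Nn) inE.
  have Nb := subsetP nNM b (subsetP sBM b Bb).
  have Nb' := subsetP nNM b' (subsetP sBM b' Bb').
  apply/andP; split.
    by rewrite memJ_norm // commgEl groupM ?groupV ?memJ_norm.
  suff <-: [~ n * b', b] = [~ n, b] ^ b'.
    by rewrite groupR ?mem_gen ?setU11 // in_setU1 in_setD1 Bb (eq_sym b b') neq_b orbT.
  rewrite commMgJ; suff ->: [~ b', b] = 1 by rewrite mulg1.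
  by apply/eqP/commgP; apply: (centsP abM); apply: (subsetP sBM).
have /subsetPn[b Bb notCb]: ~~ (B \subset 'C(N)).
  apply: contra not_abG; rewrite -gen_subG genB => cNM.
  by rewrite -defG abelianM abN abM.
have defB: B = [set b].
  apply/setP=> b'; rewrite inE; apply/idP/eqP => [Bb' | -> //].
  by apply/eqP; apply: contraR notCb; apply: cBN.
have oM: #|M| = p.
  rewrite -genB defB; apply: nt_prime_order => //.
    by rewrite Mp ?(subsetP sBM).
  by apply: contraNneq notCb => ->; apply: group1.
split=> // [|v Nv ntv].
  by rewrite -divgS // -defG TI_cardMg // mulKn ?oM.
suff ->: <<v ^: G>> = N by [].
apply: (minN_eq (class_gen_norm G v)); last by rewrite class_gen_sub.
by apply/trivgPn; exists v; rewrite ?class_gen_id.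
Qed.

Section LineComplement.

Variable K : {group gT}.
Hypothesis lineMK : line_group M K.

Let nsKM : K <| M. Proof. by case: lineMK. Qed.
Let abK : abelian K. Proof. by case: lineMK. Qed.
Let sKM : K \subset M. Proof. exact: normal_sub. Qed.
Let nKM : M \subset 'N(K). Proof. exact: normal_norm. Qed.

(** For g outside K some complement contains w and w ^ (n * g^-1), which commute
modulo N, hence commute; so w ^ g centralises [~ w, n].  By [line_outer_conj]
the whole line of w in M then centralises every [~ w, n].  The fixed points of
this line on N form a normal subgroup of G, so they are trivial or all of N, and w
centralises N in both cases. *)
Lemma line_kernel_cent : K \subset 'C(N).
Proof.
apply/subsetP=> w Kw; have [-> | ntw] := eqVneq w 1; first exact: group1.
have Mw := subsetP sKM w Kw.
pose V := <<w ^: M>>%G; have Vw : w \in V by apply: class_gen_id.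
have comm_conj n g : n \in N -> g \in M -> g \notin K -> commute (w ^ g) [~ w, n].
  move=> Nn Mg notKg; have Mg' := groupVr Mg.
  have notKg' : g^-1 \notin K by rewrite groupV.
  have Kwg : w ^ g \in K by rewrite memJ_norm // (subsetP nKM).
  have [B [irrB Bg Bw]] := line_irredundant lineMK Mg' notKg' Kw ntw.
  have Lw : w \in <<n * g^-1 |: B :\ g^-1>>.
    rewrite mem_gen // in_setU1 in_setD1 Bw andbT orbC.
    by apply/orP; left; apply: contraNneq notKg' => <-.
  have Lng : n * g^-1 \in <<n * g^-1 |: B :\ g^-1>> by rewrite mem_gen ?setU11.
  have Nwn : [~ w, n] \in N.
    by rewrite commgEr groupM // memJ_norm ?groupV // (subsetP nNM).
  set b := [~ w, n] ^ g^-1.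
  have Nb : b \in N by rewrite memJ_norm // (subsetP nNM).
  have def_wb : [~ w, w ^ (n * g^-1)] = [~ w, b].
    have -> : w ^ (n * g^-1) = w ^ g^-1 * b.
      by rewrite -conjMg commgEl mulKVg conjgM.
    rewrite commgMJ; suff -> : [~ w, w ^ g^-1] = 1 by rewrite conj1g mulg1.
    apply/eqP/commgP; apply: (centsP abK) => //.
    by rewrite memJ_norm // (subsetP nKM).
  have: [~ w, b] == 1.
    rewrite -in_set1 -[[set 1]](complement_lift irrB Bg Nn) inE.
    apply/andP; split; last by rewrite -def_wb groupR ?groupJ.
    by rewrite commgEr groupM // memJ_norm ?groupV // (subsetP nNM).
  move/commgP=> cwb; rewrite -[[~ w, n]](conjgKV g) -/b.
  by rewrite /commute -!conjMg cwb.
have cwV n g : n \in N -> g \in M -> commute (w ^ g) [~ w, n].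
  move=> Nn Mg; have [Kg | notKg] := boolP (g \in K); last exact: comm_conj.
  rewrite /conjg -(centsP abK _ Kg _ Kw) mulKg.
  apply/cent1P; apply: (line_outer_conj lineMK Kw) => g' Mg' notKg'.
  by apply/cent1P; apply: comm_conj.
have nVM : M \subset 'N(V) by apply: class_gen_norm.
have cwN n : n \in N -> [~ w, n] \in N :&: 'C(V).
  move=> Nn; rewrite inE commgEr groupM //=; last first.
    by rewrite memJ_norm ?groupV // (subsetP nNM).
  rewrite -commgEr cent_gen; apply/centP=> _ /imsetP[g Mg ->].
  by apply/commute_sym/cwV.
have nIG : G \subset 'N(N :&: 'C(V)).
  rewrite -defG mulG_subG andbC normsI ?norms_cent //=.
  by rewrite cents_norm // (subset_trans abN) // centS ?subsetIl.
(* Either [~ w, n], which lies in this intersection, is trivial, or V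
   centralises N. *)
have [I1 | ntI] := eqVneq (N :&: 'C(V)) 1.
  apply/centP=> n Nn; apply/commgP.
  by rewrite -in_set1 -[[set 1]]I1 cwN.
by apply: subsetP Vw; rewrite centsC -(minN_eq nIG ntI (subsetIl _ _)) subsetIr.
Qed.

(** The line of v = n * u with u nontrivial lies in a complement of N, so it is
isomorphic modulo N to the line of u in M and inherits its minimality. *)
Lemma line_extension : line_group G (N <*> K).
Proof.
have [_ _ pr_MK not_abM minV] := lineMK.
have cNK := line_kernel_cent.
have nNK: K \subset 'N(N) by apply: cents_norm.
have defNK : N <*> K = N * K by rewrite norm_joinEr.
have sNKG : N <*> K \subset G by rewrite join_subG sNG (subset_trans sKM).
have abNK : abelian (N <*> K) by rewrite defNK abelianM abN abK cNK.
have nNKG : G \subset 'N(N <*> K).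
  rewrite -{1}defG mulG_subG; apply/andP; split; last by rewrite normsY.
  by rewrite normsG ?joing_subl.
split=> //.
- exact/andP.
- have tiNK: N :&: K = 1 by apply/trivgP; rewrite -tiNM setIS.
  rewrite -divgS //= defNK -defG !TI_cardMg // divnMl ?cardG_gt0 //.
  by rewrite divgS.
- by apply: contra not_abM; apply: abelianS.
have /subsetPn[h Mh notKh]: ~~ (M \subset K).
  by apply: contra not_abM => sMK; apply: abelianS sMK abK.
have [defM tiKh _] := line_complement lineMK Mh notKh.
move=> v NKv ntv; move: (NKv); rewrite /= defNK => /mulsgP[n u Nn Ku def_v].
have [u1 | ntu] := eqVneq u 1.
  suff ->: <<v ^: G>> = N by [].
  apply: (minN_eq (class_gen_norm G v)).
    by apply/trivgPn; exists v; rewrite ?class_gen_id.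
  by rewrite class_gen_sub // def_v u1 mulg1.
have [B [irrB Bh Bu]] := line_irredundant lineMK Mh notKh Ku ntu.
have sVL : <<v ^: G>> \subset <<n * u |: B :\ u>>.
  rewrite gen_subG; apply/subsetP=> _ /imsetP[g Gg ->].
  move: Gg; rewrite -defG -defM mulgA -defNK => /mulsgP[x y NKx hy ->].
  have -> : v ^ (x * y) = v ^ y.
    by rewrite conjgM /conjg (centsP abNK _ NKv _ NKx) mulKg.
  rewrite groupJ //; first by rewrite def_v mem_gen ?setU11.
  apply: subsetP hy; rewrite cycle_subG mem_gen // in_setU1 in_setD1 Bh andbT.
  by apply/orP; right; apply: contraNneq notKh => ->.
have tiNV : N :&: <<v ^: G>> = 1.
  by apply/trivgP; rewrite -(complement_lift irrB Bu Nn) setIS.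
have Mu := subsetP sKM u Ku.
pose U := <<u ^: M>>%G.
have sUM : U \subset M by rewrite class_gen_sub ?normG.
have nUM : M \subset 'N(U) by apply: class_gen_norm.
have nNU : U \subset 'N(N) by apply: subset_trans nNM.
have nNUG : G \subset 'N(N <*> U).
  rewrite -{1}defG mulG_subG; apply/andP; split; last by rewrite normsY.
  by rewrite normsG ?joing_subl.
have sVNU : <<v ^: G>> \subset N <*> U.
  rewrite class_gen_sub //= norm_joinEr // def_v mem_mulg //.
  exact: class_gen_id.
apply/mingroupP; split=> [|Z /andP[ntZ nZG] sZV].
  rewrite class_gen_norm andbT; apply/trivgPn; exists v => //.
  exact: class_gen_id.
have sZG : Z \subset G.
  by rewrite (subset_trans sZV) // class_gen_sub ?normG // (subsetP sNKG).
have nNZ : Z \subset 'N(N) by apply: subset_trans nNG.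
have nXM : M \subset 'N((N <*> Z) :&: M).
  by rewrite normsI ?normG // normsY // (subset_trans sMG).
(* The image of Z in M = G / N is the line of u. *)
have sXU : (N <*> Z) :&: M \subset U.
  have sNZ: N <*> Z \subset N <*> U by rewrite join_subG joing_subl (subset_trans sZV).
  apply: subset_trans (setSI _ sNZ) _.
  rewrite [in X in X \subset _](norm_joinEr nNU) setIC.
  by rewrite -group_modr // setIC tiNM mul1g.
have ntX : (N <*> Z) :&: M != 1.
  apply: contraNneq ntZ => X1; rewrite -subG1 -tiNV subsetI sZV andbT.
  have sNZG : N <*> Z \subset G by rewrite join_subG sNG.
  have := group_modl M (joing_subl N Z); rewrite defG (setIidPr sNZG) setIC X1 mulg1.
  by move=> ->; apply: joing_subr.
have Xu : u \in (N <*> Z) :&: M.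
  case/mingroupP: (minV u Ku ntu) => _ /(_ ((N <*> Z) :&: M)%G)-> //=.
    exact: class_gen_id.
  by rewrite ntX.
move: Xu; rewrite inE norm_joinEr // => /andP[/mulsgP[n' z Nn' Zz def_u] _].
apply/eqP; rewrite eqEsubset sZV class_gen_sub //=.
have Vz := subsetP sZV z Zz.
have def_v' : v * z^-1 = n * n' by rewrite def_v def_u mulgA mulgK.
suff /eqP : v * z^-1 == 1 by move/(canRL (mulgKV z))->; rewrite mul1g.
rewrite -in_set1 -[[set 1]]tiNV inE {1}def_v' groupM //=.
by rewrite groupM ?class_gen_id ?groupV.
Qed.

End LineComplement.

End Complement.
(** Induction on the order: a complement of a minimal normal subgroup N is found
by deleting from an irredundant generating set of G a member that is redundant
modulo N. *)
Theorem set_replacement_structure G :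
    solvable G -> set_replacement G ->
  (exists2 p : nat, prime p & p.-abelem G) \/ (exists K, line_group G K).
Proof.
elim: {G}_.+1 {-2}G (ltnSn #|G|) => // m IHm G leGm solG srG.
have [G1 | ntG] := eqsVneq G 1; first by left; exists 2; rewrite // G1 abelem1.
have [N minN sNG] := minnormal_exists ntG (normG G).
have [nNG ntN abelN] := minnormal_solvable minN sNG solG.
have abN : abelian N by case/is_abelemP: abelN => p _ /abelem_abelian.
have nsNG : N <| G by apply/andP.
have [A irrA] := exists_irredundant G; have [genA irr] := irrA.
have [a Aa defG] := redundant_mod srG nsNG ntN genA.
pose M := <<A :\ a>>%G; rewrite -[<<_>>]/(gval M) in defG.
have [tiNM | sNM] := minnormal_meet minN abN defG; last first.
  by case: (irr a Aa); rewrite -[RHS]defG (mulSGid sNM).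
have srM := complement_replacement srG minN abN defG tiNM.
have sMG : M \subset G by rewrite -defG mulG_subr.
have ltMm : #|M| < m.
  rewrite -ltnS (leq_trans _ leGm) // ltnS proper_card // properEneq sMG andbT.
  by apply/eqP; apply: irr.
have [[p p_pr abelM] | [K lineMK]] := IHm M ltMm (solvableS sMG solG) srM.
  exact: abelian_complement srG minN abN defG tiNM _ p_pr abelM abelN.
by right; exists (N <*> K)%G; apply: line_extension lineMK.
Qed.

End Structure.

(** * Coordinates on a line group *)

Section LineCoordinates.
Variable gT : finGroupType.
Variables (G K : {group gT}).
Hypothesis lineGK : line_group G K.

Let nsKG : K <| G. Proof. by case: lineGK. Qed.
Let abK : abelian K. Proof. by case: lineGK. Qed.
Let nKG : G \subset 'N(K). Proof. exact: normal_norm. Qed.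

Let line_sub v : v \in K -> <<v ^: G>> \subset K.
Proof. by rewrite class_gen_sub. Qed.

Definition equivariant_embedding (V : {group gT}) (phi : gT -> gT) :=
  [/\ {in V &, {morph phi : x y / x * y}},
      {in V & G, forall x g, phi (x ^ g) = phi x ^ g}
    & forall x, x \in V -> phi x = 1 -> x = 1].

(** If u is not on the line V of v, the line of v * u is the graph of an
isomorphism between V and the line U of u: it meets both trivially, so V embeds
into the product of this graph with U and is projected onto U. *)
Lemma line_embedding v u : v \in K -> v != 1 -> u \in K -> u != 1 ->
  exists2 phi, equivariant_embedding <<v ^: G>>%G phi &
    forall x, x \in <<v ^: G>> -> phi x \in <<u ^: G>>.
Proof.
move=> Kv ntv Ku ntu; have [Vu | notVu] := boolP (u \in <<v ^: G>>).
  exists id; first by split=> // x _ ->.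
  move=> x; apply: subsetP; suff <- : <<u ^: G>> = <<v ^: G>> by [].
  apply: (line_eq lineGK Kv ntv (class_gen_norm _ _)).
    by apply/trivgPn; exists u; rewrite ?class_gen_id.
  by rewrite class_gen_sub ?class_gen_norm.
have Kvu := groupM Kv Ku.
have ntvu : v * u != 1.
  apply: contraNneq notVu => vu1; rewrite -[u](mulKg v) vu1 mulg1 groupV.
  exact: class_gen_id.
have tiVW : <<v ^: G>> :&: <<(v * u) ^: G>> = 1.
  apply/eqP; apply: contraR notVu => ntI.
  have := line_meet lineGK Kvu ntvu (class_gen_norm G v) ntI.
  by rewrite groupMl ?class_gen_id.
have tiWU : <<(v * u) ^: G>> :&: <<u ^: G>> = 1.
  apply/eqP; apply: contraR notVu; rewrite setIC => ntI.
  have := line_meet lineGK Kvu ntvu (class_gen_norm G u) ntI.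
  rewrite groupMr ?class_gen_id // => Uv.
  apply: (line_meet lineGK Ku ntu (class_gen_norm G v)).
  by apply/trivgPn; exists v; rewrite // inE class_gen_id.
set W := <<(v * u) ^: G>>%G in tiVW tiWU; set U := <<u ^: G>>%G in tiWU.
have sWK : W \subset K by apply: line_sub.
have sUK : U \subset K by apply: line_sub.
have nUW : U \subset 'N(W) by rewrite cents_norm ?(centSS sUK sWK abK).
have sVWU : <<v ^: G>> \subset W * U.
  rewrite -norm_joinEr // class_gen_sub ?normsY ?class_gen_norm //=.
  rewrite norm_joinEr //; apply/mulsgP; exists (v * u) u^-1.
  - exact: class_gen_id.
  - by rewrite groupV class_gen_id.
  by rewrite mulgK.
have comp : U \in [complements to W in W <*> U].
  by apply/complP; split; rewrite // norm_joinEr.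
have nsWWU : W <| W <*> U by rewrite /normal joing_subl join_subG normG.
(* The projection onto U along the graph W. *)
exists (remgr W U); last by move=> x /(subsetP sVWU)/mem_remgr.
split=> [x y Vx Vy | x g Vx Gg | x Vx phi1].
- by rewrite (remgrM comp nsWWU) //= norm_joinEr // (subsetP sVWU).
- have WUx := subsetP sVWU x Vx.
  rewrite {1}(divgr_eq W U x) conjMg remgrMid ?memJ_norm //.
  + exact: mem_divgr.
  + by apply: subsetP Gg; apply: class_gen_norm.
  + exact: mem_remgr.
  by apply: subsetP Gg; apply: class_gen_norm.
apply/eqP; rewrite -in_set1 -[[set 1]]tiVW inE Vx.
by rewrite (divgr_eq W U x) phi1 mulg1 mem_divgr // (subsetP sVWU).
Qed.

Variable V : {group gT}.
Notation power t := (power_group V t).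
Notation fpower t := {dffun forall _ : 'I_t, gT}.

Definition conj_power t (x : fpower t) g : fpower t := [ffun i => x i ^ g].

Definition power_embedding t (f : fpower t -> gT) :=
  [/\ forall x y, x \in power t -> y \in power t -> f (x * y) = f x * f y,
      forall x, x \in power t -> f x \in K,
      forall x g, x \in power t -> g \in G -> f (conj_power x g) = f x ^ g
    & forall x, x \in power t -> f x = 1 -> x = 1].

Definition extend_power t (f : fpower t -> gT) (phi : gT -> gT) (x : fpower t.+1) :=
  f [ffun i => x (lift ord0 i)] * phi (x ord0).

Lemma extend_power_embedding t f phi (U : {group gT}) :
    power_embedding f -> equivariant_embedding V phi -> U \subset K ->
    (forall x, x \in V -> phi x \in U) ->
    (forall x, x \in power t -> f x \in U -> f x = 1) ->
  power_embedding (extend_power f phi).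
Proof.
move=> [fM fK fJ f1] [phiM phiJ phi1] sUK Uphi tif.
have tail x : x \in power t.+1 -> ([ffun i => x (lift ord0 i)] : fpower t) \in power t.
  by move/setXnP=> Vx; apply/setXnP=> i; rewrite ffunE.
have head x : x \in power t.+1 -> x ord0 \in V by move/setXnP.
have Kphi x : x \in power t.+1 -> phi (x ord0) \in K.
  by move/head/Uphi; apply: (subsetP sUK).
rewrite /extend_power; split=> [x y Px Py | x Px | x g Px Gg | x Px].
- rewrite ffunE phiM ?head //.
  have -> : [ffun i => (x * y) (lift ord0 i)] =
            ([ffun i => x (lift ord0 i)] : fpower t) * [ffun i => y (lift ord0 i)].
    by apply/ffunP=> i; rewrite !ffunE.
  rewrite fM ?tail // -!mulgA; congr (_ * _); rewrite !mulgA; congr (_ * _).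
  by apply: (centsP abK); rewrite ?fK ?tail ?Kphi.
- by rewrite groupM ?fK ?tail ?Kphi.
- rewrite ffunE phiJ ?head // conjMg -fJ ?tail //; congr (f _ * _).
  by apply/ffunP=> i; rewrite !ffunE.
move=> fphi1; have phiU : phi (x ord0) \in U by rewrite Uphi ?head.
have ft1 : f [ffun i => x (lift ord0 i)] = 1.
  by rewrite tif ?tail // -(groupMr _ phiU) fphi1 group1.
move: fphi1; rewrite ft1 mul1g => /(phi1 _ (head x Px)) x01.
have/ffunP xt1 := f1 _ (tail x Px) ft1.
apply/ffunP=> i; rewrite [RHS]ffunE; case: (unliftP ord0 i) => [j ->|->//].
by have := xt1 j; rewrite !ffunE.
Qed.

End LineCoordinates.

Section Coordinates.

Variable gT : finGroupType.
Variables (G K : {group gT}).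
Hypothesis lineGK : line_group G K.
Variables (v : gT).
Hypotheses (Kv : v \in K) (ntv : v != 1).

Let V := <<v ^: G>>%G.

(** An embedded power of the line V of v that misses some u in K meets the line of
u trivially, so a copy of V mapped into that line gives one more coordinate.  The
order of K bounds the number of steps. *)
Lemma line_coordinates :
  exists t (f : {dffun forall _ : 'I_t, gT} -> gT),
    power_embedding G K V f
    /\ forall y, y \in K -> exists2 x, x \in power_group V t & y = f x.
Proof.
pose im t (f : {dffun forall _ : 'I_t, gT} -> gT) := f @: power_group V t.
have step m : forall t (f : {dffun forall _ : 'I_t, gT} -> gT),
    power_embedding G K V f ->
    #|K| <= #|im t f| + m ->
  exists t' (f' : {dffun forall _ : 'I_t', gT} -> gT),
    power_embedding G K V f' /\ K \subset im t' f'.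
  elim: m => [|m IHm] t f embf le_K.
    have [_ fK _ _] := embf; exists t, f; split=> //.
    have sfK : im t f \subset K by apply/subsetP=> _ /imsetP[x Px ->]; apply: fK.
    have /eqP-> // : im t f == K.
    by rewrite eqEcard sfK -[X in _ <= X]addn0.
  have [sKf | /subsetPn[u Ku notfu]] := boolP (K \subset im t f).
    by exists t, f.
  have [fM fK fJ f1] := embf; pose fm := @Morphism _ _ (power_group V t) f fM.
  have def_im : im t f = fm @* power_group V t by rewrite morphimEdom.
  have nIG : G \subset 'N(fm @* power_group V t).
    apply/subsetP=> g Gg; rewrite inE -def_im.
    apply/subsetP=> _ /imsetP[_ /imsetP[x Px ->] ->].
    rewrite -fJ //; apply: imset_f; apply/setXnP=> i; rewrite ffunE memJ_norm.
      by move/setXnP: Px.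
    by apply: subsetP Gg; apply: class_gen_norm.
  have ntu : u != 1 by apply: contraNneq notfu => ->; rewrite def_im group1.
  have [phi embphi Uphi] := line_embedding lineGK Kv ntv Ku ntu.
  have [phiM _ phi1] := embphi.
  have tif x : x \in power_group V t -> f x \in <<u ^: G>> -> f x = 1.
    move=> Px Ufx; apply/eqP; apply: contraR notfu => ntfx; rewrite def_im.
    apply: (line_meet lineGK Ku ntu nIG); apply/trivgPn; exists (f x) => //.
    by apply/setIP; split; rewrite //= -def_im imset_f.
  have sUK : <<u ^: G>> \subset K.
    by case: lineGK => /andP[_ nKG] _ _ _ _; rewrite class_gen_sub.
  apply: (IHm t.+1 (extend_power f phi)).
    pose U := <<u ^: G>>%G.
    exact: extend_power_embedding lineGK _ _ _ _ U embf embphi sUK Uphi tif.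
  have imE x w : x \in power_group V t -> w \in V ->
      f x * phi w \in im t.+1 (extend_power f phi).
    move=> Px Vw; pose x' : {dffun forall _ : 'I_t.+1, gT} :=
      [ffun i => if unlift ord0 i is Some j then x j else w].
    apply/imsetP; exists x'.
      apply/setXnP=> i; rewrite ffunE; case: unliftP => // j _.
      by move/setXnP: Px.
    rewrite /extend_power [x' ord0]ffunE unlift_none; congr (f _ * _).
    by apply/ffunP=> i; rewrite !ffunE liftK.
  have phi_1 : phi 1 = 1.
    by apply: (mulgI (phi 1)); rewrite -phiM ?group1 // !mulg1.
  have f_1 : f 1 = 1 := morph1 fm.
  rewrite addnS -addSn in le_K; apply: leq_trans le_K _; rewrite leq_add2r.
  apply: proper_card; apply/properP; split.
    apply/subsetP=> _ /imsetP[x Px ->].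
    by rewrite -[f x]mulg1 -phi_1 imE ?group1.
  have Vv : v \in V by apply: class_gen_id.
  exists (phi v); first by rewrite -[phi v]mul1g -f_1 imE ?group1.
  apply: contra ntv => /imsetP[x Px def_x]; apply/eqP/phi1 => //.
  by rewrite def_x tif // -def_x Uphi.
pose f0 (x : {dffun forall _ : 'I_0, gT}) : gT := 1.
have emb0 : power_embedding G K V f0.
  split=> [x y _ _ | x _ | x g _ _ | x _ _]; rewrite /f0 ?mulg1 ?group1 ?conj1g //.
  by apply/ffunP=> [[]].
have [t [f [embf sKf]]] := step _ _ _ emb0 (leq_addl _ _).
by exists t, f; split=> // y /(subsetP sKf)/imsetP[x Px ->]; exists x.
Qed.
End Coordinates.

Lemma line_group_sdprod (gT : finGroupType) (G K : {group gT}) :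
    line_group G K ->
  exists (hT vT : finGroupType) (H : {group hT}) (V : {group vT})
     (to : groupAction H V) (t : nat),
     [/\ 0 < t, cyclic H /\ prime #|H|, abelian V /\ V :!=: 1,
         [faithful H, on V | to] /\ acts_irreducibly H V to
       & G \isog [set: sdprod_by (diag_groupAction to t)]].
Proof.
move=> lineGK; have [nsKG abK pr_GK not_abG minV] := lineGK.
have [sKG nKG] := andP nsKG.
have /subsetPn[h Gh notKh]: ~~ (G \subset K).
  by apply: contra not_abG => sGK; apply: abelianS sGK abK.
have [defG tiKh oh] := line_complement lineGK Gh notKh.
have [v Kv ntv] : exists2 v, v \in K & v != 1.
  apply/trivgPn; apply: contra not_abG => /eqP K1.
  by rewrite -defG K1 mul1g cycle_abelian.
pose V := <<v ^: G>>%G; pose H := <[h]>%G.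
have Vv : v \in V by apply: class_gen_id.
have sVK : V \subset K by rewrite class_gen_sub.
have sHG : H \subset G by rewrite cycle_subG.
have nVH : H \subset 'N(V) by apply: subset_trans (class_gen_norm G v).
have actsVH : {acts H, on group V | 'J%gact}.
  by split; rewrite ?subsetT //= astabsJ.
pose to := actby_groupAction actsVH.
have [t [f [embf fK]]] := line_coordinates lineGK Kv ntv.
have [fM fKin fJ f1] := embf.
pose fm := @Morphism _ _ (power_group V t) f fM.
exists gT, gT, H, V, to, t; split.
- rewrite lt0n; apply: contraNneq ntv => t0; have [x _ ->] := fK v Kv.
  rewrite -(morph1 fm) /=; apply/eqP; congr f; apply/ffunP=> i.
  by have := ltn_ord i; rewrite [X in _ < X]t0.
- by rewrite cycle_cyclic; split; rewrite // -[#|_|]/#[h] oh.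
- split; first exact: abelianS sVK abK.
  by apply/trivgPn; exists v.
- split.
    rewrite /faithful astab_actby setIid astabJ setIA setIid prime_TIg //.
      by rewrite -[#|_|]/#[h] oh.
    apply: contra ntv => cVH; apply/eqP/(line_center lineGK Kv).
    rewrite inE (subsetP sKG) //= -defG centM inE (subsetP abK) //=.
    by apply: subsetP Vv; rewrite centsC.
  have minVG := minV v Kv ntv.
  apply/mingroupP; split=> [|Z /andP[ntZ actsZ] sZV].
    have /andP[-> _] := mingroupp minVG.
    by rewrite acts_actby subxx setIid /= astabsJ.
  case/mingroupP: minVG => _; apply => //; rewrite ntZ -defG mulG_subG /=.
  rewrite cents_norm; last exact: centSS (subxx K) (subset_trans sZV sVK) abK.
  by move: actsZ; rewrite acts_actby subxx (setIidPr sZV) /= astabsJ.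
have act_fm : {in power_group V t & H, morph_act (diag_groupAction to t) 'J fm (idm H)}.
  move=> x a Px Ha; rewrite /= /diagact Ha Px -fJ ?(subsetP sHG) //.
  congr f; apply/ffunP=> i; rewrite !ffunE /= /actby Ha andbT ifT //.
  by move/setXnP: Px.
rewrite isog_sym; apply/isogP; exists (xsdprod_morphism act_fm).
  have im_fm : fm @* power_group V t \subset K.
    by apply/subsetP=> _ /morphimP[x _ Px ->]; apply: fKin.
  rewrite injm_xsdprodm injm_idm im_idm /= -subG1 -tiKh setSI // !andbT.
  apply/subsetP=> x kx; rewrite inE; apply/eqP/f1; first exact: dom_ker kx.
  exact: (mker kx).
rewrite im_xsdprodm im_idm -{1}defG; congr (_ * _).
apply/setP=> y; apply/morphimP/idP=> [[x _ Px ->] | /fK[x Px ->]]; first exact: fKin.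
by exists x.
Qed.

(** * Semidirect products of a homogeneous module *)

Lemma injm_line_group (aT rT : finGroupType) (D G K : {group aT})
    (f : {morphism D >-> rT}) :
  'injm f -> G \subset D -> line_group G K -> line_group (f @* G) (f @* K).
Proof.
move=> injf sGD [nsKG abK pr_GK not_abG minV]; have sKG := normal_sub nsKG.
have sKD := subset_trans sKG sGD.
split; first exact: morphim_normal.
- exact: morphim_abelian.
- by rewrite index_injm.
- by rewrite injm_abelian.
move=> _ /morphimP[v Dv Kv ->] ntfv.
have -> : <<f v ^: (f @* G)>> = f @* <<v ^: G>>.
  by rewrite morphim_gen ?morphim_class // class_subG.
rewrite injm_minnormal //; last by rewrite gen_subG class_subG.
by apply: minV => //; apply: contraNneq ntfv => ->; rewrite morph1.
Qed.

Section Sdprod.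

Variables (hT vT : finGroupType) (H : {group hT}) (V : {group vT}).
Variables (to : groupAction H V) (t : nat).
Hypotheses (t_gt0 : 0 < t) (pr_H : prime #|H|) (abV : abelian V).
Hypotheses (faithH : [faithful H, on V | to]) (irrV : acts_irreducibly H V to).

Let abH : abelian H. Proof. by rewrite cyclic_abelian ?prime_cyclic. Qed.

(** The bare function type avoids carrying morphism structures through products
of endomorphisms. *)
Definition equivariant_endo (phi : vT -> vT) :=
  [/\ forall u, u \in V -> phi u \in V,
      forall u w, u \in V -> w \in V -> phi (u * w) = phi u * phi w
    & forall u a, u \in V -> a \in H -> phi (to u a) = to (phi u) a].

(** Schur's lemma. *)
Lemma equivariant_ker phi u : equivariant_endo phi -> u \in V -> u != 1 ->
  phi u = 1 -> forall w, w \in V -> phi w = 1.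
Proof.
move=> [phiV phiM phiJ] Vu ntu phiu.
pose f := @Morphism _ _ V phi phiM.
have sKV : 'ker f \subset V by apply: subsetIl.
have defK : 'ker f = V.
  case/mingroupP: irrV => _ /(_ ('ker f)%G)-> //; apply/andP; split.
    by apply/trivgPn; exists u => //; apply/kerP.
  apply/subsetP=> a Ha; rewrite !inE Ha; apply/subsetP=> w kw.
  have Vw := subsetP sKV w kw; rewrite inE; apply/kerP; rewrite /= ?gact_stable //.
  by rewrite phiJ // -[phi w]/(f w) (mker kw) gact1.
by move=> w; rewrite -defK => /mker.
Qed.

Notation P := (power_group V t).
Notation sdT := (sdprod_by (diag_groupAction to t)).
Notation inV := (sdpair1 (diag_groupAction to t)).
Notation inH := (sdpair2 (diag_groupAction to t)).

(** The normal closure of x is the cyclic H-module spanned by x, and since H is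
abelian each operation of the group ring of H is an equivariant endomorphism of
V, the same one in all coordinates. *)
Lemma sdprod_conj x y : x \in P -> y \in <<inV x ^: [set: sdT]>> ->
  exists z phi, [/\ z \in P, equivariant_endo phi, y = inV z & forall i, z i = phi (x i)].
Proof.
move=> Px /gen_prodgP[n [c xc ->]].
have Vx i : x i \in V by move/setXnP: Px.
elim/big_rec: _ => [|i y' _ [z [phi [Pz [phiV phiM phiJ] -> def_z]]]].
  exists 1, (fun=> 1); split; rewrite ?group1 ?morph1 //.
    2: by move=> i; rewrite ffunE.
  by split=> [u _|u w _ _|u a _ Ha]; rewrite ?group1 ?mulg1 ?gact1.
have /imsetP[g _ ->] := xc i.
have: g \in inV @* P * inH @* H by rewrite im_sdpair inE.
case/mulsgP=> _ _ /morphimP[p _ Pp ->] /morphimP[a _ Ha ->] ->.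
have -> : inV x ^ (inV p * inH a) = inV (diagact to x a).
  rewrite conjgM -morphJ //; have -> : x ^ p = x.
    apply/conjg_fixP/commgP/ffunP=> j; rewrite !ffunE.
    by apply: (centsP abV) => //; move/setXnP: Pp.
  by rewrite -sdpair_act.
exists (diagact to x a * z), (fun u => to u a * phi u).
have Pxa : diagact to x a \in P by rewrite diagact_stable.
split; rewrite ?groupM ?morphM //; last first.
  by move=> j; rewrite ffunE def_z /diagact Ha Px /= ffunE.
split=> [u Vu | u w Vu Vw | u b Vu Hb].
- by rewrite groupM ?gact_stable ?phiV.
- rewrite gactM // phiM // -!mulgA; congr (_ * _); rewrite !mulgA; congr (_ * _).
  by apply: (centsP abV); rewrite ?gact_stable ?phiV.
rewrite gactM ?gact_stable ?phiV // phiJ // -!actMin //.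
by rewrite (centsP abH a Ha b Hb).
Qed.

Lemma power_group_abelian : abelian P.
Proof.
apply/centsP=> x /setXnP Px y /setXnP Py; apply/ffunP=> i; rewrite !ffunE.
exact: (centsP abV).
Qed.

(** Let Z be normal, nontrivial and inside the normal closure of x, and x i
nontrivial.  By Schur's lemma an element of this normal closure is determined by
its i-th coordinate.  The i-th coordinates of Z form a nontrivial H-submodule of
V, that is V, so x itself lies in Z. *)
Lemma sdprod_line_group : line_group [set: sdT] (inV @* P).
Proof.
have nsP : inV @* P <| [set: sdT].
  by have /sdprod_context[] := sdprod_sdpair (diag_groupAction to t).
have inH_inj := injm_sdpair2 (diag_groupAction to t).
have inV_inj := injm_sdpair1 (diag_groupAction to t).
split=> //.
- exact: morphim_abelian power_group_abelian.
- by rewrite -(index_sdprod (sdprod_sdpair _)) card_injm.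
- apply/negP=> abT; have: H \subset [1].
    apply: subset_trans faithH; rewrite subsetI subxx; apply/subsetP=> a Ha.
    rewrite !inE Ha; apply/subsetP=> u Vu; rewrite inE; apply/eqP.
    pose x : {dffun forall _ : 'I_t, vT} := [ffun=> u].
    have Px : x \in P by apply/setXnP=> i; rewrite ffunE.
    have /(injmP inV_inj) : inV (diagact to x a) = inV x.
      rewrite sdpair_act // /conjg (centsP abT _ (in_setT _) _ (in_setT (inH a))).
      by rewrite mulKg.
    rewrite diagact_stable => /(_ Px Px)/ffunP/(_ (Ordinal t_gt0)).
    by rewrite /diagact Ha Px !ffunE.
  by rewrite subG1 => /eqP H1; move: pr_H; rewrite H1 cards1.
move=> _ /morphimP[x _ Px ->] ntx.
have [i ntxi] : exists i, x i != 1.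
  apply/existsP; apply: contraR ntx; rewrite negb_exists => /forallP x1.
  suff -> : x = 1 by rewrite morph1.
  by apply/ffunP=> i; rewrite ffunE; apply/eqP; have := x1 i; rewrite negbK.
have Vx j : x j \in V by move/setXnP: Px.
apply/mingroupP; split=> [|Z /andP[ntZ nZT] sZW].
  rewrite class_gen_norm andbT; apply/trivgPn; exists (inV x) => //.
  exact: class_gen_id.
have coord_ker z phi : z \in P -> equivariant_endo phi -> (forall j, z j = phi (x j)) ->
    z i = 1 -> z = 1.
  move=> Pz embphi def_z zi; apply/ffunP=> j; rewrite ffunE def_z.
  by apply: (equivariant_ker embphi (Vx i) ntxi); rewrite -?def_z.
pose L := (dffun_morphism (fun _ : 'I_t => vT) i @* (inV @*^-1 Z))%G.
have sLV : L \subset V.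
  apply/subsetP=> _ /morphimP[y _ /morphpreP[/setXnP Py _] ->].
  exact: Py.
have defL : L :=: V.
  case/mingroupP: irrV => _; apply=> //.
  apply/andP; split.
    have [y Zy nty] := trivgPn _ ntZ.
    have [z [phi [Pz embphi def_y def_z]]] := sdprod_conj Px (subsetP sZW y Zy).
    apply/trivgPn; exists (z i).
      apply/morphimP; exists z => //.
      by apply/morphpreP; split; rewrite //= -def_y.
    apply: contraNneq nty => zi; by rewrite def_y (coord_ker z phi) ?morph1.
  apply/subsetP=> a Ha; rewrite !inE Ha.
  apply/subsetP=> _ /morphimP[y _ /morphpreP[Py Zy] ->].
  rewrite inE; apply/morphimP; exists (diagact to y a); first exact: in_setT.
    apply/morphpreP; rewrite diagact_stable; split=> //.
    by rewrite /= sdpair_act // memJ_norm // (subsetP nZT) ?inE.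
  by rewrite /= /diagact Ha Py ffunE.
have: x i \in L by rewrite defL.
case/morphimP=> y _ /morphpreP[Py Zy] /= def_xi.
apply/eqP; rewrite eqEsubset sZW class_gen_sub //=.
suff <- : y = x by [].
have Wyx : inV (y * x^-1) \in <<inV x ^: [set: sdT]>>.
  by rewrite morphM ?groupV // morphV // groupM ?groupV ?class_gen_id // (subsetP sZW).
have [z [phi [Pz embphi def_yx def_z]]] := sdprod_conj Px Wyx.
have {}def_yx : y * x^-1 = z.
  by apply: (injmP inV_inj) def_yx; rewrite ?groupM ?groupV.
apply/eqP; rewrite eq_mulgV1 def_yx; apply/eqP; apply: coord_ker Pz embphi def_z _.
by rewrite -def_yx !ffunE -def_xi mulgV.
Qed.

End Sdprod.

Theorem theorem2 (gT : finGroupType) (G : {group gT}) (solG : solvable G) :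
  strong_replacement_property G <->
  (exists2 p : nat, prime p & p.-abelem G) \/
  (exists (hT vT : finGroupType) (H : {group hT}) (V : {group vT})
     (to : groupAction H V) (t : nat),
     [/\ 0 < t, cyclic H /\ prime #|H|, abelian V /\ V :!=: 1,
         [faithful H, on V | to] /\ acts_irreducibly H V to
       & G \isog [set: sdprod_by (diag_groupAction to t)]]).
Proof.
split=> [/set_replacementP srG | caseG].
  have [abelG | [K lineGK]] := set_replacement_structure solG srG; first by left.
  by right; apply: line_group_sdprod lineGK.
apply/set_replacementP.
case: caseG => [[p p_pr abelG] | ]; first exact: abelem_replacement p_pr abelG.
case=> hT [vT [H [V [to [t [t_gt0 [_ pr_H] [abV _] [faithH irrV] isoG]]]]]].
move: isoG; rewrite isog_sym => /isogP[f injf imf].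
have defG : (f @* [set: sdprod_by (diag_groupAction to t)])%G = G by apply: val_inj.
have lineT := sdprod_line_group t_gt0 pr_H abV faithH irrV.
by rewrite -defG; apply: line_set_replacement (injm_line_group injf (subxx _) lineT).
Qed.
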